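(* Let $v_1,v_2,v_3>0$ be constant velocities such that $v_3\leq v_2<v_1$, and set $$\theta=\frac{v_1(v_2-v_3)}{v_1v_2-v_3^2},\qquad \varphi=\frac{v_2(v_1-v_3)}{v_1v_2-v_3^2}.$$ Let $f\colon\triangle\to\triangle$ be the reset function of the three-worker bucket brigade with these constant velocities, where $\triangle=\{(x,y)\colon 0\leq x\leq y\leq 1\}$, and let $p^\star=\Bigl(\frac{v_1}{v_1+v_2+v_3},\frac{v_1+v_2}{v_1+v_2+v_3}\Bigr)$ be its unique fixed point. Then there are initial positions in $\triangle$ for each of the following asymptotic behaviors of the system: (i) it remains at the fixed point $p^\star$; (ii) it reaches after finitely many resets the $3$-cycle $(1,1)\mapsto(0,1)\mapsto(0,0)\mapsto(1,1)$ of $f$ (that is, the worker positions after resets cycle through $(0,1,1)$, $(0,0,1)$, $(0,0,0)$); (iii) it reaches after finitely many resets the $3$-cycle $(\varphi,\varphi)\mapsto(\theta,1)\mapsto(0,\theta)\mapsto(\varphi,\varphi)$ of $f$ (that is, the worker positions after resets cycle through $(0,\varphi,\varphi)$, $(0,\theta,1)$, $(0,0,\theta)$). Moreover, there is no other asymptotic behavior: every initial position in $\triangle$ leads to (i), (ii), or (iii).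
   Context: Three-worker bucket brigade with constant velocities $v_1,v_2,v_3>0$. Three workers, numbered $1,2,3$ along a production line identified with $[0,1]$, have positions $0\leq x_1\leq x_2\leq x_3\leq 1$. All workers move forward. Worker $3$ always moves at velocity $v_3$. For $i\in\{1,2\}$, worker $i$ moves at velocity $v_i$ as long as he has not caught up with worker $i+1$. When he has caught up with worker $i+1$, he cannot overtake him and adjusts his velocity to that of worker $i+1$. Formally, $\dot x_3=v_3$, and for $i=1,2$: $\dot x_i=v_i$ if $x_i<x_{i+1}$, and $\dot x_i=\min(v_i,\dot x_{i+1})$ if $x_i=x_{i+1}$. Let $T$ be the smallest time $t\geq 0$ with $x_3(t)=1$. At time $T$ a reset occurs instantaneously: worker $3$ is sent to position $x_2(T)$, worker $2$ to position $x_1(T)$, and worker $1$ to position $0$. The reset function $f\colon\triangle\to\triangle$ maps $(x,y)$ to $(x',y')$, where, starting at time $0$ from positions $(x_1,x_2,x_3)=(0,x,y)$, the positions just after the first reset are $(0,x',y')$; that is, $x'=x_1(T)$ and $y'=x_2(T)$. A point $(x,y)\in\triangle$ is identified with the initial position $(0,x,y)$ of the workers. From initial position $(x,y)$, the system ''remains at the fixed point'' if $f^k(x,y)=p^\star$ for all $k\geq 0$, and ''reaches a cycle after finitely many resets'' if $f^k(x,y)$ is a point of that cycle for some $k\geq 0$. *)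

(* Defs.v *)
From Stdlib Require Import Reals Lra ClassicalEpsilon.
From Coquelicot Require Import Coquelicot.
Open Scope R_scope.

Definition in_triangle (p : R * R) : Prop := 0 <= fst p <= snd p /\ snd p <= 1.

(* Velocities jump when a worker catches up with the next one, so [dx/dt] is
   the right derivative: the velocity with which the worker proceeds. *)
Definition is_right_derive (x : R -> R) (t l : R) : Prop :=
  filterlim (fun s => (x s - x t) / (s - t)) (at_right t) (locally l).

Definition follows (v T : R) (x y : R -> R) : Prop :=
  forall t, 0 <= t < T ->
    (x t < y t -> is_right_derive x t v) /\
    (x t = y t ->
      exists w, is_right_derive y t w /\ is_right_derive x t (Rmin v w)).

Record motion (v1 v2 v3 T : R) (x1 x2 x3 : R -> R) : Prop := {
  motion_cont1 : continuous_on (fun t => 0 <= t <= T) x1;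
  motion_cont2 : continuous_on (fun t => 0 <= t <= T) x2;
  motion_cont3 : continuous_on (fun t => 0 <= t <= T) x3;
  motion_order :
    forall t, 0 <= t <= T -> 0 <= x1 t <= x2 t /\ x2 t <= x3 t <= 1;
  motion_vel3 : forall t, 0 <= t < T -> is_right_derive x3 t v3;
  motion_vel2 : follows v2 T x2 x3;
  motion_vel1 : follows v1 T x1 x2
}.

Definition resets_to (v1 v2 v3 : R) (p q : R * R) : Prop :=
  exists (T : R) (x1 x2 x3 : R -> R),
    0 <= T /\
    motion v1 v2 v3 T x1 x2 x3 /\
    (x1 0 = 0 /\ x2 0 = fst p /\ x3 0 = snd p) /\
    (x3 T = 1 /\ forall t, 0 <= t < T -> x3 t <> 1) /\
    q = (x1 T, x2 T).

(* For positive velocities and [p] in the triangle this is the unique [q] with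
   [resets_to v1 v2 v3 p q]: see [reset_spec] and [resets_to_unique].  The value
   elsewhere is irrelevant. *)
Definition reset (v1 v2 v3 : R) (p : R * R) : R * R :=
  epsilon (inhabits p) (resets_to v1 v2 v3 p).

Definition is_3cycle (f : R * R -> R * R) (a b c : R * R) : Prop :=
  (in_triangle a /\ in_triangle b /\ in_triangle c) /\
  (a <> b /\ b <> c /\ c <> a) /\
  (f a = b /\ f b = c /\ f c = a).

Definition remains_at (f : R * R -> R * R) (p q : R * R) : Prop :=
  forall k : nat, Nat.iter k f p = q.

Definition reaches_cycle (f : R * R -> R * R) (p a b c : R * R) : Prop :=
  exists k : nat,
    Nat.iter k f p = a \/ Nat.iter k f p = b \/ Nat.iter k f p = c.

Lemma is_right_derive_eps x t l :
  is_right_derive x t l <->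
  forall eps, 0 < eps -> exists d, 0 < d /\
    forall s, t < s < t + d -> Rabs (x s - x t - l * (s - t)) <= eps * (s - t).
Proof.
unfold is_right_derive; rewrite filterlim_locally; split.
- intros H eps He; destruct (H (mkposreal eps He)) as [d Hd].
  exists d; split; [apply cond_pos|]; intros s Hs.
  assert (Hb : ball t d s).
  { apply Rabs_def1; unfold minus, plus, opp; simpl; lra. }
  assert (K := Hd s Hb (proj1 Hs)).
  change (Rabs ((x s - x t) / (s - t) - l) < eps) in K.
  replace (x s - x t - l * (s - t))
    with (((x s - x t) / (s - t) - l) * (s - t)) by (field; lra).
  rewrite Rabs_mult, (Rabs_pos_eq (s - t)) by lra.
  apply Rmult_le_compat_r; lra.
- intros H eps.
  destruct (H (eps / 2)) as [d [Hd K]]; [destruct eps; simpl; lra|].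
  exists (mkposreal d Hd); intros s Hb Hs.
  change (Rabs (s - t) < d) in Hb; apply Rabs_def2 in Hb.
  specialize (K s ltac:(lra)).
  change (Rabs ((x s - x t) / (s - t) - l) < eps).
  replace ((x s - x t) / (s - t) - l)
    with ((x s - x t - l * (s - t)) / (s - t)) by (field; lra).
  unfold Rdiv; rewrite Rabs_mult, Rabs_inv, (Rabs_pos_eq (s - t)) by lra.
  apply Rle_lt_trans with (eps / 2); [|destruct eps; simpl; lra].
  apply Rmult_le_reg_r with (s - t); [lra|].
  rewrite Rmult_assoc, Rinv_l by lra; lra.
Qed.

Lemma is_right_derive_unique x t l l' :
  is_right_derive x t l -> is_right_derive x t l' -> l = l'.
Proof.
intros H H'; exact (filterlim_locally_unique _ l l' H H').
Qed.

Lemma is_right_derive_minus x y t l m :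
  is_right_derive x t l -> is_right_derive y t m ->
  is_right_derive (fun s => x s - y s) t (l - m).
Proof.
rewrite !is_right_derive_eps; intros Hx Hy eps He.
destruct (Hx (eps / 2)) as [d [Hd K]]; [lra|].
destruct (Hy (eps / 2)) as [d' [Hd' K']]; [lra|].
exists (Rmin d d'); split; [now apply Rmin_pos|]; intros s Hs.
assert (A := Rmin_l d d'); assert (B := Rmin_r d d').
specialize (K s ltac:(lra)); specialize (K' s ltac:(lra)).
apply Rabs_le_between in K; apply Rabs_le_between in K'.
apply Rabs_le_between; lra.
Qed.

Lemma is_right_derive_lin c v t : is_right_derive (fun s => c + v * s) t v.
Proof.
apply is_right_derive_eps; intros eps He; exists 1; split; [lra|]; intros s Hs.
replace (c + v * s - (c + v * t) - v * (s - t)) with 0 by ring.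
rewrite Rabs_R0; apply Rmult_le_pos; lra.
Qed.

Lemma is_right_derive_min_lt x y t l m :
  x t < y t -> is_right_derive x t l -> is_right_derive y t m ->
  is_right_derive (fun s => Rmin (x s) (y s)) t l.
Proof.
intros Hxy Hx Hy.
assert (Hd := is_right_derive_minus y x t m l Hy Hx).
rewrite is_right_derive_eps in Hx, Hd |- *; intros eps He.
destruct (Hx eps He) as [d [Hd0 K]].
destruct (Hd 1 Rlt_0_1) as [d' [Hd' K']].
set (r := (y t - x t) / (2 + Rabs (m - l))).
assert (A0 := Rabs_pos (m - l)).
assert (Hr : 0 < r) by (apply Rdiv_lt_0_compat; lra).
assert (Er : r * (2 + Rabs (m - l)) = y t - x t) by (unfold r; field; lra).
exists (Rmin d (Rmin d' r)); split; [repeat apply Rmin_pos; lra|]; intros s Hs.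
assert (A := Rmin_l d (Rmin d' r)); assert (B := Rmin_r d (Rmin d' r)).
assert (A' := Rmin_l d' r); assert (B' := Rmin_r d' r).
specialize (K s ltac:(lra)); specialize (K' s ltac:(lra)).
apply Rabs_le_between in K'.
assert (C := Rle_abs (- (m - l))); rewrite Rabs_Ropp in C.
assert (x s < y s) by nra.
rewrite (Rmin_left (x s)), (Rmin_left (x t)) by lra; exact K.
Qed.

Lemma is_right_derive_min_eq x y t l m :
  x t = y t -> is_right_derive x t l -> is_right_derive y t m ->
  is_right_derive (fun s => Rmin (x s) (y s)) t (Rmin l m).
Proof.
rewrite !is_right_derive_eps; intros E Hx Hy eps He.
destruct (Hx eps He) as [d [Hd K]].
destruct (Hy eps He) as [d' [Hd' K']].
exists (Rmin d d'); split; [now apply Rmin_pos|]; intros s Hs.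
assert (A := Rmin_l d d'); assert (B := Rmin_r d d').
specialize (K s ltac:(lra)); specialize (K' s ltac:(lra)).
apply Rabs_le_between in K; apply Rabs_le_between in K'.
apply Rabs_le_between; rewrite (Rmin_left (x t)) by lra.
unfold Rmin; destruct (Rle_dec (x s) (y s)), (Rle_dec l m); nra.
Qed.

Lemma is_right_derive_ext x y t l :
  (forall s, x s = y s) -> is_right_derive x t l -> is_right_derive y t l.
Proof.
intros E; apply filterlim_ext; intros s; now rewrite !E.
Qed.

Lemma continuous_lin c v t : continuous (fun s => c + v * s) t.
Proof.
apply (continuous_plus (fun _ => c) (fun s => v * s));
  [apply continuous_const|].
apply (continuous_mult (fun _ => v) (fun s => s));
  [apply continuous_const|apply continuous_id].
Qed.

Lemma continuous_continuous_on (D : R -> Prop) (x : R -> R) :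
  (forall t, continuous x t) -> continuous_on D x.
Proof.
intros H t _; refine (filterlim_filter_le_1 x _ (H t)).
apply filter_le_within; apply locally_filter.
Qed.

Lemma continuous_on_minus (D : R -> Prop) (x y : R -> R) :
  continuous_on D x -> continuous_on D y ->
  continuous_on D (fun t => x t - y t).
Proof.
intros Hx Hy t Dt.
apply (@filterlim_comp_2 _ _ _ _ _ (locally (x t)) (locally (opp (y t))) _ _
         x (fun s => opp (y s)) plus).
- now apply Hx.
- eapply filterlim_comp; [now apply Hy|apply (filterlim_opp (V := R_NormedModule))].
- apply (filterlim_plus (V := R_NormedModule)).
Qed.

Lemma continuous_on_eps (D : R -> Prop) (x : R -> R) :
  continuous_on D x -> forall t eps, D t -> 0 < eps -> exists d, 0 < d /\
    forall s, D s -> Rabs (s - t) < d -> Rabs (x s - x t) < eps.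
Proof.
intros H t eps Dt He.
assert (K := proj1 (filterlim_locally _ _) (H t Dt) (mkposreal eps He)).
destruct K as [d K]; exists d; split; [apply cond_pos|].
intros s Ds Hs; exact (K s Hs Ds).
Qed.

Lemma right_derive_barrier (g : R -> R) (b : R) :
  0 <= b -> continuous_on (fun t => 0 <= t <= b) g -> g 0 <= 0 ->
  (forall t, 0 <= t < b -> 0 < g t ->
     exists l, l <= 0 /\ is_right_derive g t l) ->
  g b <= 0.
Proof.
intros Hb Hc H0 Hd.
assert (cont := continuous_on_eps _ _ Hc).
assert (Main : forall eps, 0 < eps -> g b <= eps * (1 + b)).
{ intros eps He.
  set (S := fun t => 0 <= t <= b /\
              forall s, 0 <= s <= t -> g s <= eps * (1 + s)).
  assert (S0 : S 0).
  { split; [lra|]; intros s Hs; replace s with 0 by lra; lra. }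
  destruct (completeness S) as [c [Hub Hlub]].
  { exists b; intros t [Ht _]; lra. }
  { now exists 0. }
  assert (Hc0 : 0 <= c) by now apply Hub.
  assert (Hcb : c <= b) by (apply Hlub; intros t [Ht _]; lra).
  assert (Hlt : forall s, 0 <= s < c -> g s <= eps * (1 + s)).
  { intros s Hs.
    destruct (classic (exists t, S t /\ s < t)) as [[t [[Ht St] Hst]]|N].
    - apply St; lra.
    - exfalso; assert (c <= s); [|lra].
      apply Hlub; intros t St.
      destruct (Rle_lt_dec t s); [lra|]; exfalso; apply N; now exists t. }
  assert (Hgc : g c <= eps * (1 + c)).
  { destruct (Rle_lt_dec (g c) (eps * (1 + c))) as [|K]; [lra|exfalso].
    destruct (Req_dec c 0) as [->|Hcn]; [nra|].
    destruct (cont c (g c - eps * (1 + c))) as [d [Hd0 Kd]]; [lra|lra|].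
    set (s := Rmax 0 (c - d / 2)).
    assert (A := Rmax_l 0 (c - d / 2)); assert (B := Rmax_r 0 (c - d / 2)).
    fold s in A, B.
    assert (s < c) by (unfold s, Rmax; destruct Rle_dec; lra).
    specialize (Kd s ltac:(lra) ltac:(apply Rabs_def1; lra)).
    apply Rabs_def2 in Kd.
    specialize (Hlt s ltac:(lra)); nra. }
  assert (HSc : S c).
  { split; [lra|]; intros s Hs.
    destruct (Req_dec s c) as [->|]; [easy|]; apply Hlt; lra. }
  destruct (Req_dec c b) as [<-|Hne]; [easy|exfalso].
  assert (Ext : exists d, 0 < d /\ forall s, c < s < c + d -> s <= b ->
                  g s <= eps * (1 + s)).
  { destruct (Rle_lt_dec (g c) 0) as [Hn|Hp].
    - destruct (cont c eps) as [d [Hd0 Kd]]; [lra|lra|].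
      exists d; split; [easy|]; intros s Hs Hsb.
      specialize (Kd s ltac:(lra) ltac:(apply Rabs_def1; lra)).
      apply Rabs_def2 in Kd; nra.
    - destruct (Hd c ltac:(lra) Hp) as [l [Hl Kl]].
      destruct (proj1 (is_right_derive_eps _ _ _) Kl eps He) as [d [Hd0 Kd]].
      exists d; split; [easy|]; intros s Hs _.
      specialize (Kd s Hs); apply Rabs_le_between in Kd; nra. }
  destruct Ext as [d [Hd0 Kd]].
  set (u := Rmin b (c + d / 2)).
  assert (A := Rmin_l b (c + d / 2)); assert (B := Rmin_r b (c + d / 2)).
  fold u in A, B.
  assert (c < u) by (apply Rmin_glb_lt; lra).
  assert (S u); [|specialize (Hub u ltac:(easy)); lra].
  split; [lra|]; intros s Hs.
  destruct (Rle_lt_dec s c); [apply HSc; lra|apply Kd; lra]. }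
destruct (Rle_lt_dec (g b) 0) as [|K]; [lra|exfalso].
assert (M := Main (g b / (2 * (1 + b)))
               ltac:(apply Rdiv_lt_0_compat; lra)).
replace (g b / (2 * (1 + b)) * (1 + b)) with (g b / 2) in M by (field; lra).
lra.
Qed.

Lemma continuous_on_le (T t : R) (x : R -> R) :
  t <= T -> continuous_on (fun s => 0 <= s <= T) x ->
  continuous_on (fun s => 0 <= s <= t) x.
Proof.
intros H; apply continuous_on_subset; intros s Hs; lra.
Qed.

Lemma motion_leader v1 v2 v3 T x1 x2 x3 :
  motion v1 v2 v3 T x1 x2 x3 ->
  forall t, 0 <= t <= T -> x3 t = x3 0 + v3 * t.
Proof.
intros M t Ht; set (z := fun s => x3 0 + v3 * s).
assert (Cz : continuous_on (fun s => 0 <= s <= t) z).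
{ apply continuous_continuous_on; intros s; apply continuous_lin. }
assert (C3 := continuous_on_le T t x3 (proj2 Ht) (motion_cont3 _ _ _ _ _ _ _ M)).
assert (D3 : forall s, 0 <= s < t -> is_right_derive x3 s v3).
{ intros s Hs; apply (motion_vel3 _ _ _ _ _ _ _ M); lra. }
apply Rle_antisym; apply Rminus_le.
- apply (right_derive_barrier (fun s => x3 s - z s) t);
    [lra|now apply continuous_on_minus|unfold z; lra|].
  intros s Hs _; exists (v3 - v3); split; [lra|].
  apply is_right_derive_minus; [now apply D3|apply is_right_derive_lin].
- apply (right_derive_barrier (fun s => z s - x3 s) t);
    [lra|now apply continuous_on_minus|unfold z; lra|].
  intros s Hs _; exists (v3 - v3); split; [lra|].
  apply is_right_derive_minus; [apply is_right_derive_lin|now apply D3].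
Qed.

Lemma follows_le v T (x y x' y' : R -> R) :
  0 <= T ->
  continuous_on (fun t => 0 <= t <= T) x ->
  continuous_on (fun t => 0 <= t <= T) x' ->
  (forall t, 0 <= t <= T -> x t <= y t) ->
  (forall t, 0 <= t <= T -> x' t <= y' t) ->
  (forall t, 0 <= t <= T -> y t = y' t) ->
  follows v T x y -> follows v T x' y' -> x 0 = x' 0 ->
  forall t, 0 <= t <= T -> x t <= x' t.
Proof.
intros HT Cx Cx' Lx Lx' Ey F F' E0 t Ht; apply Rminus_le.
apply (right_derive_barrier (fun s => x s - x' s) t); [lra| |lra|].
- apply continuous_on_minus; apply continuous_on_le with T; easy || lra.
- intros s Hs Hp.
  assert (I : 0 <= s <= T) by lra.
  specialize (Lx s I); specialize (Lx' s I); specialize (Ey s I).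
  destruct (F s ltac:(lra)) as [F1 F2].
  assert (D' := proj1 (F' s ltac:(lra)) ltac:(lra)).
  destruct (Rle_lt_or_eq_dec _ _ Lx) as [L|E].
  + exists (v - v); split; [lra|]; now apply is_right_derive_minus; auto.
  + destruct (F2 E) as [w [_ Dw]].
    exists (Rmin v w - v); split; [assert (A := Rmin_l v w); lra|].
    now apply is_right_derive_minus.
Qed.

Lemma resets_to_unique v1 v2 v3 p q q' :
  0 < v3 -> resets_to v1 v2 v3 p q -> resets_to v1 v2 v3 p q' -> q = q'.
Proof.
intros H3 (T & x1 & x2 & x3 & HT & M & (A1 & A2 & A3) & (E & _) & ->).
intros (T' & y1 & y2 & y3 & HT' & M' & (B1 & B2 & B3) & (E' & _) & ->).
assert (L := motion_leader _ _ _ _ _ _ _ M).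
assert (L' := motion_leader _ _ _ _ _ _ _ M').
assert (T' = T) as ->.
{ specialize (L T ltac:(lra)); specialize (L' T' ltac:(lra)).
  apply Rmult_eq_reg_l with v3; lra. }
destruct M as [C1 C2 _ O _ F2 F1], M' as [C1' C2' _ O' _ F2' F1'].
assert (X3 : forall t, 0 <= t <= T -> x3 t = y3 t).
{ intros t Ht; rewrite L, L' by easy; lra. }
assert (X2 : forall t, 0 <= t <= T -> x2 t = y2 t).
{ intros t Ht; apply Rle_antisym.
  - apply (follows_le v2 T x2 x3 y2 y3); try easy; try lra; intros s Hs;
      [apply O|apply O']; easy.
  - apply (follows_le v2 T y2 y3 x2 x3); try easy; try lra; intros s Hs;
      [apply O'|apply O|symmetry; apply X3]; easy. }
assert (X1 : forall t, 0 <= t <= T -> x1 t = y1 t).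
{ intros t Ht; apply Rle_antisym.
  - apply (follows_le v1 T x1 x2 y1 y2); try easy; try lra; intros s Hs;
      [apply O|apply O']; easy.
  - apply (follows_le v1 T y1 y2 x1 x2); try easy; try lra; intros s Hs;
      [apply O'|apply O|symmetry; apply X2]; easy. }
now rewrite X1, X2 by lra.
Qed.

Lemma continuous_Rmin (x y : R -> R) t :
  continuous x t -> continuous y t -> continuous (fun s => Rmin (x s) (y s)) t.
Proof.
intros Hx Hy; apply filterlim_locally; intros eps.
generalize (filter_and _ _ (proj1 (filterlim_locally _ _) Hx eps)
                           (proj1 (filterlim_locally _ _) Hy eps)).
apply filter_imp; intros s [A B].
change (Rabs (x s - x t) < eps) in A; change (Rabs (y s - y t) < eps) in B.
change (Rabs (Rmin (x s) (y s) - Rmin (x t) (y t)) < eps).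
apply Rabs_def2 in A; apply Rabs_def2 in B.
unfold Rmin; destruct Rle_dec, Rle_dec; apply Rabs_def1; lra.
Qed.

Lemma resets_to_explicit v1 v2 v3 x y :
  0 < v1 -> 0 < v2 -> 0 < v3 -> in_triangle (x, y) ->
  let T := (1 - y) / v3 in
  let b := Rmin (x + v2 * T) 1 in
  resets_to v1 v2 v3 (x, y) (Rmin (v1 * T) b, b).
Proof.
intros H1 H2 H3 [[P0 P1] P2]; cbn [fst snd] in P0, P1, P2.
set (T := (1 - y) / v3); intros b.
assert (ET : y + v3 * T = 1) by (unfold T; field; lra).
assert (HT : 0 <= T) by (apply Rle_mult_inv_pos; lra).
set (z1 := fun t => 0 + v1 * t); set (z2 := fun t => x + v2 * t).
set (x3 := fun t => y + v3 * t).
set (x2 := fun t => Rmin (z2 t) (x3 t)); set (x1 := fun t => Rmin (z1 t) (x2 t)).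
assert (D1 : forall t, is_right_derive z1 t v1) by
  (intros; apply is_right_derive_lin).
assert (D2 : forall t, is_right_derive z2 t v2) by
  (intros; apply is_right_derive_lin).
assert (D3 : forall t, is_right_derive x3 t v3) by
  (intros; apply is_right_derive_lin).
assert (C2 : forall t, continuous x2 t) by
  (intros; apply continuous_Rmin; apply continuous_lin).
assert (C1 : forall t, continuous x1 t) by
  (intros; apply continuous_Rmin; [apply continuous_lin|apply C2]).
assert (R2 : forall t, (z2 t < x3 t /\ x2 t = z2 t /\ is_right_derive x2 t v2) \/
   (z2 t = x3 t /\ x2 t = x3 t /\ is_right_derive x2 t (Rmin v2 v3)) \/
   (x3 t < z2 t /\ x2 t = x3 t /\ is_right_derive x2 t v3)).
{ intros t; destruct (Rtotal_order (z2 t) (x3 t)) as [L|[E|L]].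
  - left; split; [easy|]; split; [apply Rmin_left; lra|].
    now apply is_right_derive_min_lt with v3.
  - right; left; split; [easy|]; split; [apply Rmin_right; lra|].
    now apply is_right_derive_min_eq.
  - right; right; split; [easy|]; split; [apply Rmin_right; lra|].
    apply is_right_derive_ext with (fun s => Rmin (x3 s) (z2 s));
      [intros; apply Rmin_comm|].
    now apply is_right_derive_min_lt with v2. }
exists T, x1, x2, x3.
split; [easy|]; split; [|split; [|split]].
- split.
  + now apply continuous_continuous_on.
  + now apply continuous_continuous_on.
  + apply continuous_continuous_on; intros t; apply continuous_lin.
  + intros t Ht.
    assert (0 <= v1 * t) by (apply Rmult_le_pos; lra).
    assert (0 <= v2 * t) by (apply Rmult_le_pos; lra).
    assert (0 <= v3 * t) by (apply Rmult_le_pos; lra).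
    assert (v3 * t <= v3 * T) by (apply Rmult_le_compat_l; lra).
    split; split.
    * repeat apply Rmin_glb; unfold z1, z2, x3; lra.
    * apply Rmin_r.
    * apply Rmin_r.
    * unfold x3; lra.
  + intros; apply D3.
  + intros t Ht; destruct (R2 t) as [(L & E & D)|[(L & E & D)|(L & E & D)]];
      (split; [intros K; try easy; lra|intros K; exists v3; split; [apply D3|]]).
    * lra.
    * exact D.
    * rewrite Rmin_right; [exact D|]; unfold x3, z2 in L; nra.
  + intros t Ht.
    assert (W : exists w, is_right_derive x2 t w /\ (x2 t < z1 t -> w <= v1)).
    { destruct (R2 t) as [(L & E & D)|[(L & E & D)|(L & E & D)]].
      - exists v2; split; [easy|]; rewrite E; unfold z1, z2; nra.
      - exists (Rmin v2 v3); split; [easy|]; rewrite E; unfold z1, x3; intros K.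
        apply Rle_trans with v3; [apply Rmin_r|nra].
      - exists v3; split; [easy|]; rewrite E; unfold z1, x3; nra. }
    destruct W as [w [Dw Hw]].
    destruct (Rtotal_order (z1 t) (x2 t)) as [L|[E|L]].
    * assert (E : x1 t = z1 t) by (apply Rmin_left; lra).
      split; [intros _|lra].
      now apply is_right_derive_min_lt with w.
    * assert (E' : x1 t = x2 t) by (apply Rmin_right; lra).
      split; [lra|intros _; exists w; split; [easy|]].
      now apply is_right_derive_min_eq.
    * assert (E' : x1 t = x2 t) by (apply Rmin_right; lra).
      split; [lra|intros _; exists w; split; [easy|]].
      rewrite Rmin_right by auto.
      apply is_right_derive_ext with (fun s => Rmin (x2 s) (z1 s));
        [intros; apply Rmin_comm|].
      now apply is_right_derive_min_lt with v1.
- assert (E2 : x2 0 = x).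
  { unfold x2, z2, x3; rewrite Rmin_left; lra. }
  split; [|split; [exact E2|unfold x3; cbn [snd]; lra]].
  unfold x1; rewrite E2; unfold z1; rewrite Rmin_left; lra.
- split; [exact ET|]; intros t Ht; unfold x3.
  assert (v3 * t < v3 * T) by (apply Rmult_lt_compat_l; lra); lra.
- unfold x1, x2, z1, z2, x3, b; now rewrite ET, Rplus_0_l.
Qed.

Lemma reset_spec v1 v2 v3 p :
  0 < v1 -> 0 < v2 -> 0 < v3 -> in_triangle p ->
  resets_to v1 v2 v3 p (reset v1 v2 v3 p).
Proof.
intros H1 H2 H3 Hp; unfold reset; apply epsilon_spec; destruct p as [x y].
eexists; now apply resets_to_explicit.
Qed.

Lemma resets_to_triangle v1 v2 v3 p q :
  resets_to v1 v2 v3 p q -> in_triangle q.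
Proof.
intros (T & x1 & x2 & x3 & HT & [_ _ _ O _ _ _] & _ & _ & ->).
specialize (O T ltac:(lra)); unfold in_triangle; simpl; lra.
Qed.

(* Main.v *)
(* After rescaling time so that the last worker has velocity 1, one reset is the
   piecewise linear map [brigade a b], with velocity ratios a > b >= 1.  On its
   generic piece it is affine with fixed point p* and linear part of
   characteristic polynomial X^2 + b X + a, whose roots both have modulus > 1; an
   explicit quadratic form grows by the factor a / b at each step, so every orbit
   other than p* leaves this piece.  All other pieces are mapped to the diagonal
   or to the edge y = 1, and the edge goes to the diagonal in two resets.  On the
   diagonal the third iterate multiplies the distance to (phi, phi) by a b > 1
   until the orbit falls into the cycle of (1, 1). *)
Require Import Defs.
From Stdlib Require Import Reals Lra Classical.
From Coquelicot Require Import Rcomplements.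
Open Scope R_scope.

(** * Reduction to a piecewise linear map with two parameters *)

Definition brigade (a b : R) (p : R * R) : R * R :=
  let y' := Rmin (fst p + b * (1 - snd p)) 1 in
  (Rmin (a * (1 - snd p)) y', y').

(** In the time [(1 - y) / v3] before the reset, an unhindered worker covers [1 - y] times his
    velocity ratio to worker 3, so only these ratios matter. *)
Lemma reset_brigade v1 v2 v3 p :
  0 < v1 -> 0 < v2 -> 0 < v3 -> in_triangle p ->
  reset v1 v2 v3 p = brigade (v1 / v3) (v2 / v3) p.
Proof.
intros h1 h2 h3 hp.
apply (resets_to_unique v1 v2 v3 p); [easy|now apply reset_spec|].
destruct p as [x y].
assert (K := resets_to_explicit v1 v2 v3 x y h1 h2 h3 hp); cbv zeta in K.
unfold brigade; cbn [fst snd].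
replace (v1 / v3 * (1 - y)) with (v1 * ((1 - y) / v3)) by (field; lra).
replace (v2 / v3 * (1 - y)) with (v2 * ((1 - y) / v3)) by (field; lra).
exact K.
Qed.

Lemma brigade_triangle a b p :
  0 < a -> 0 < b -> in_triangle p -> in_triangle (brigade a b p).
Proof.
destruct p as [x y]; unfold in_triangle, brigade; cbn [fst snd]; intros ha hb hp.
assert (0 <= a * (1 - y)) by (apply Rmult_le_pos; lra).
assert (0 <= b * (1 - y)) by (apply Rmult_le_pos; lra).
split; [split|]; [|apply Rmin_r|apply Rmin_r].
repeat apply Rmin_glb; lra.
Qed.

(** Invariance of the triangle is part of the induction because [reset] is identified with [brigade]
    only there. *)
Lemma iter_reset v1 v2 v3 p k :
  0 < v1 -> 0 < v2 -> 0 < v3 -> in_triangle p ->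
  in_triangle (Nat.iter k (reset v1 v2 v3) p) /\
  Nat.iter k (reset v1 v2 v3) p = Nat.iter k (brigade (v1 / v3) (v2 / v3)) p.
Proof.
intros h1 h2 h3 hp; induction k as [|k [IH E]]; [easy|].
rewrite !Nat.iter_succ, <- E, reset_brigade by easy; split; [|easy].
apply brigade_triangle; [| |easy]; now apply Rdiv_lt_0_compat.
Qed.

Lemma reaches_cycle_step f p u v w :
  reaches_cycle f (f p) u v w -> reaches_cycle f p u v w.
Proof.
intros [k H]; exists (S k); now rewrite Nat.iter_succ_r.
Qed.

(** The orbit is constant, whereas no point of a 3-cycle is fixed. This yields the uniqueness of
    [pstar]. *)
Lemma fixed_not_reaches_cycle f p u v w :
  f p = p -> is_3cycle f u v w -> ~ reaches_cycle f p u v w.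
Proof.
intros E (_ & N & C) [k H].
assert (I : Nat.iter k f p = p).
{ clear H; induction k as [|k IH]; [easy|]; rewrite Nat.iter_succ; congruence. }
rewrite I in H; intuition congruence.
Qed.

(** While the orbit avoids [G] it stays in [P] and [W] grows geometrically, against the bound [M];
    once [G] holds, it is pulled back to the start. This serves for the third iterate on the
    diagonal and for a single reset on the triangle. *)
Lemma escape {X : Type} (f : X -> X) (G P : X -> Prop) (W : X -> R) (r M : R) :
  1 < r ->
  (forall z, G (f z) -> G z) ->
  (forall z, P z -> W z <= M) ->
  (forall z, P z -> G z \/ (P (f z) /\ r * W z <= W (f z))) ->
  forall z, P z -> 0 < W z -> G z.
Proof.
intros hr back bound step.
assert (H : forall n z, P z -> M < r ^ n * W z -> G z).
{ induction n as [|n IH]; intros z hz hM.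
  - specialize (bound z hz); simpl in hM; lra.
  - destruct (step z hz) as [g|[hf hW]]; [easy|].
    apply back, IH; [easy|].
    assert (0 < r ^ n) by (apply pow_lt; lra).
    simpl in hM; nra. }
intros z hz hW.
destruct (Pow_x_infinity r) with (b := (Rabs M + 1) / W z) as [n hn].
{ rewrite Rabs_pos_eq; lra. }
apply (H n); [easy|].
specialize (hn n (le_n n)); rewrite Rabs_pos_eq in hn by (apply pow_le; lra).
apply Rge_le, (Rmult_le_compat_r (W z)) in hn; [|lra].
replace ((Rabs M + 1) / W z * W z) with (Rabs M + 1) in hn by (field; lra).
assert (A := Rle_abs M); lra.
Qed.

Definition settles (a b : R) (p : R * R) : Prop :=
  let theta := a * (b - 1) / (a * b - 1) in
  let phi := b * (a - 1) / (a * b - 1) in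
  reaches_cycle (brigade a b) p (1, 1) (0, 1) (0, 0) \/
  reaches_cycle (brigade a b) p (phi, phi) (theta, 1) (0, theta).

Lemma settles_step a b p : settles a b (brigade a b p) -> settles a b p.
Proof.
intros [H|H]; [left|right]; now apply reaches_cycle_step.
Qed.

(** * Orbits on the boundary of the triangle *)

(** Worker 2 starts level with worker 3 and, as [1 <= b], stays with him to the end of the line. *)
Lemma brigade_diagonal a b c :
  1 <= b -> c <= 1 -> brigade a b (c, c) = (Rmin (a * (1 - c)) 1, 1).
Proof.
intros hb hc; unfold brigade; cbn [fst snd].
rewrite (Rmin_right (c + _)) by nra; easy.
Qed.

Lemma brigade_edge a b x : 0 <= x <= 1 -> brigade a b (x, 1) = (0, x).
Proof.
intros hx; unfold brigade; cbn [fst snd].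
rewrite (Rmin_left (x + _)) by lra; rewrite Rmin_left by lra; f_equal; lra.
Qed.

(** Worker 1 starts level with worker 2 and, as [b <= a], stays with him, so the image is on the
    diagonal. *)
Lemma brigade_wall a b y :
  b <= a -> y <= 1 ->
  brigade a b (0, y) = (Rmin (b * (1 - y)) 1, Rmin (b * (1 - y)) 1).
Proof.
intros hb hy; unfold brigade; cbn [fst snd].
rewrite Rplus_0_l; f_equal; apply Rmin_right.
apply Rle_trans with (b * (1 - y)); [apply Rmin_l|nra].
Qed.

Lemma brigade3_diagonal a b c :
  1 <= b <= a -> 0 <= c <= 1 -> 0 <= a * (1 - c) <= 1 ->
  let d := Rmin (b * (1 - a * (1 - c))) 1 in
  brigade a b (brigade a b (brigade a b (c, c))) = (d, d).
Proof.
intros hb hc hs d; rewrite brigade_diagonal, Rmin_left by lra.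
now rewrite brigade_edge, brigade_wall by lra.
Qed.

Lemma settles_diagonal a b c :
  1 <= b < a -> 0 <= c <= 1 -> settles a b (c, c).
Proof.
intros hb hc.
set (phi := b * (a - 1) / (a * b - 1)).
assert (hab : 1 < a * b) by nra.
(* [phi] is the fixed point of the untruncated third iterate, an affine map of slope [a * b] on the
   diagonal. *)
assert (Ephi : phi = b * (1 - a * (1 - phi))) by (unfold phi; field; lra).
destruct (Req_dec c phi) as [->|hne].
{ right; exists 0%nat; now left. }
set (f3 := fun p => brigade a b (brigade a b (brigade a b p))).
set (M := 1 + Rabs phi).
apply (escape f3 (settles a b)
         (fun p => fst p = snd p /\ 0 <= fst p <= 1)
         (fun p => Rabs (fst p - phi)) (a * b) M); cbn [fst snd].
- easy.
- intros p H; now do 3 apply settles_step.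
- intros p [_ hp].
  apply Rle_trans with (1 := Rabs_triang (fst p) (- phi)).
  rewrite Rabs_Ropp, (Rabs_pos_eq (fst p)) by lra; unfold M; lra.
- intros [x y]; cbn [fst snd]; intros [<- hx].
  (* Truncation at 1 sends the orbit to [(1, 1)]: here after one reset, in the next case distinction
     after three. *)
  destruct (Rle_lt_dec 1 (a * (1 - x))) as [h|h].
  { left; left; apply reaches_cycle_step.
    rewrite brigade_diagonal, Rmin_right by lra.
    exists 0%nat; now left. }
  assert (hs : 0 <= a * (1 - x)) by (apply Rmult_le_pos; lra).
  unfold f3; rewrite (brigade3_diagonal a b x) by lra; cbn [fst snd].
  destruct (Rle_lt_dec 1 (b * (1 - a * (1 - x)))) as [k|k].
  { left; do 3 apply settles_step.
    rewrite (brigade3_diagonal a b x) by lra; rewrite Rmin_right by lra.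
    left; exists 0%nat; now left. }
  right; rewrite Rmin_left by lra; split; [split; [easy|split; nra]|].
  replace (b * (1 - a * (1 - x)) - phi) with (a * b * (x - phi)) by lra.
  rewrite Rabs_mult, (Rabs_pos_eq (a * b)); lra.
- easy.
- apply Rabs_pos_lt; lra.
Qed.

Lemma settles_edge a b x :
  1 <= b < a -> 0 <= x <= 1 -> settles a b (x, 1).
Proof.
intros hb hx; do 2 apply settles_step.
rewrite brigade_edge, brigade_wall by lra.
apply settles_diagonal; [easy|split; [|apply Rmin_r]].
apply Rmin_glb; nra.
Qed.

(** * The generic affine piece and expansion away from the fixed point *)

(** If worker 2 catches worker 3, the image lies on the edge [y = 1]; otherwise, if worker 1 catches
    worker 2, it lies on the diagonal. If nobody is caught, the map is affine. *)
Lemma brigade_cases a b p :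
  1 <= b < a -> in_triangle p ->
  settles a b p \/
  brigade a b p = (a * (1 - snd p), fst p + b * (1 - snd p)).
Proof.
intros hb hp.
assert (hq : in_triangle (brigade a b p)) by (apply brigade_triangle; lra || easy).
destruct p as [x y]; unfold in_triangle in hp, hq; cbn [fst snd] in hp |- *.
destruct (Rle_lt_dec 1 (x + b * (1 - y))) as [h|h].
{ left; apply settles_step; unfold brigade in hq |- *; cbn [fst snd] in hq |- *.
  rewrite (Rmin_right (x + _)) in hq |- * by lra.
  apply settles_edge; [easy|lra]. }
destruct (Rle_lt_dec (x + b * (1 - y)) (a * (1 - y))) as [k|k].
{ left; apply settles_step; unfold brigade in hq |- *; cbn [fst snd] in hq |- *.
  rewrite (Rmin_left (x + _)), Rmin_right in hq |- * by lra.
  apply settles_diagonal; [easy|lra]. }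
right; unfold brigade; cbn [fst snd].
rewrite (Rmin_left (x + _)), Rmin_left by lra; easy.
Qed.

(* A discrete Lyapunov function for w(n+1) + b w(n) + a w(n-1) = 0, with
   p = w(n-1) and q = w(n). *)
Definition energy (a b r p q : R) : R :=
  (a + r) * (r * p ^ 2 + q ^ 2) + 2 * b * r * p * q.

(** For [r <= a] the right-hand side is nonnegative, so the energy grows at least by the factor
    [r]. *)
Lemma energy_step a b r p q :
  energy a b r q (- b * q - a * p) - r * energy a b r p q =
  (a - r) * ((a + r) * p + b * q) ^ 2.
Proof.
unfold energy; ring.
Qed.

(** The bound on [b ^ 2 * r] says that the discriminant of the form is negative; the proof completes
    the square. *)
Lemma energy_pos a b r p q :
  0 < a -> 0 < r -> b ^ 2 * r < (a + r) ^ 2 -> p <> 0 \/ q <> 0 ->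
  0 < energy a b r p q.
Proof.
intros ha hr hd hpq.
apply Rmult_lt_reg_l with (a + r); [lra|]; rewrite Rmult_0_r.
replace ((a + r) * energy a b r p q)
  with (((a + r) * q + b * r * p) ^ 2 + r * ((a + r) ^ 2 - b ^ 2 * r) * p ^ 2)
  by (unfold energy; ring).
assert (hk : 0 < r * ((a + r) ^ 2 - b ^ 2 * r)) by (apply Rmult_lt_0_compat; lra).
destruct (Req_dec p 0) as [->|hp].
- assert (hq : q <> 0) by tauto.
  assert (0 < ((a + r) * q + b * r * 0) ^ 2); [|lra].
  replace ((a + r) * q + b * r * 0) with ((a + r) * q) by ring.
  rewrite <- Rsqr_pow2; apply Rlt_0_sqr, Rmult_integral_contrapositive; lra.
- apply Rplus_le_lt_0_compat; [apply pow2_ge_0|].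
  apply Rmult_lt_0_compat; [easy|rewrite <- Rsqr_pow2; now apply Rlt_0_sqr].
Qed.

Lemma energy_bound a b r p q :
  0 < a -> 0 < b -> 0 < r -> Rabs p <= 1 -> Rabs q <= 1 ->
  energy a b r p q <= (a + r) * (r + 1) + 2 * b * r.
Proof.
intros ha hb hr hp hq; unfold energy.
apply Rabs_le_between in hp; apply Rabs_le_between in hq.
assert (p ^ 2 <= 1) by nra.
assert (q ^ 2 <= 1) by nra.
assert (p * q <= 1) by nra.
assert (0 < b * r) by (apply Rmult_lt_0_compat; lra).
apply Rplus_le_compat; [apply Rmult_le_compat_l; nra|nra].
Qed.

Lemma fixed_or_settles a b p :
  1 <= b < a -> in_triangle p ->
  p = (a / (a + b + 1), (a + b) / (a + b + 1)) \/ settles a b p.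
Proof.
intros hb hp.
set (xs := a / (a + b + 1)); set (ys := (a + b) / (a + b + 1)).
assert (Ex : a * (1 - ys) = xs) by (unfold xs, ys; field; lra).
assert (Ey : xs + b * (1 - ys) = ys) by (unfold xs, ys; field; lra).
assert (hys : 0 <= ys <= 1).
{ unfold ys; split; [apply Rle_mult_inv_pos; lra|].
  apply Rle_div_l; lra. }
assert (hxs : 0 <= xs <= 1) by nra.
destruct (classic (p = (xs, ys))) as [|hne]; [now left|right].
(* This ratio exceeds 1, is at most [a], and satisfies [b ^ 2 * r = a * b < (a + r) ^ 2], as growth
   and positivity of the energy require. *)
set (r := a / b).
assert (Er : r * b = a) by (unfold r; field; lra).
assert (hr : 1 < r) by nra.
assert (hra : r <= a) by nra.
(* On the affine piece the new [x - xs] is [- a] times the old [y - ys], so [- (x - xs) / a] stands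
   for the preceding deviation of [y]. *)
apply (escape (brigade a b) (settles a b) in_triangle
         (fun z => energy a b r (- (fst z - xs) / a) (snd z - ys)) r
         ((a + r) * (r + 1) + 2 * b * r)).
- easy.
- intros z; apply settles_step.
- intros [x y]; unfold in_triangle; cbn [fst snd]; intros hz.
  apply energy_bound; [lra|lra|lra| |apply Rabs_le_between; lra].
  apply Rabs_le_between; split; [apply Rle_div_r|apply Rle_div_l]; lra.
- intros z hz; destruct (brigade_cases a b z hb hz) as [g|E]; [now left|right].
  split; [apply brigade_triangle; lra || easy|]; rewrite E; cbn [fst snd].
  set (u := - (fst z - xs) / a); set (w := snd z - ys).
  assert (K := energy_step a b r u w).
  replace (- (a * (1 - snd z) - xs) / a) with w by
    (rewrite <- Ex; unfold w; field; lra).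
  replace (fst z + b * (1 - snd z) - ys) with (- b * w - a * u); cycle 1.
  { replace (a * u) with (xs - fst z) by (unfold u; field; lra).
    unfold w; lra. }
  assert (0 <= (a - r) * ((a + r) * u + b * w) ^ 2); [|lra].
  apply Rmult_le_pos; [lra|apply pow2_ge_0].
- easy.
- apply energy_pos; [lra|lra| |].
  + replace (b ^ 2 * r) with (a * b) by (rewrite <- Er; ring); nra.
  + apply not_and_or; intros [hu hw]; apply hne.
    destruct p as [x y]; cbn [fst snd] in hu, hw; f_equal; [|lra].
    replace x with (xs - a * (- (x - xs) / a)) by (field; lra).
    rewrite hu; ring.
Qed.

Theorem theorem1p3 (v1 v2 v3 : R)
    (hv1 : 0 < v1) (hv2 : 0 < v2) (hv3 : 0 < v3)
    (h32 : v3 <= v2) (h21 : v2 < v1) :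
  let theta := v1 * (v2 - v3) / (v1 * v2 - v3 ^ 2) in
  let phi := v2 * (v1 - v3) / (v1 * v2 - v3 ^ 2) in
  let f := reset v1 v2 v3 in
  let pstar := (v1 / (v1 + v2 + v3), (v1 + v2) / (v1 + v2 + v3)) in
  (* p* is the unique fixed point, and (ii), (iii) are 3-cycles of f *)
  (in_triangle pstar /\ f pstar = pstar /\
     forall p, in_triangle p -> f p = p -> p = pstar) /\
  is_3cycle f (1, 1) (0, 1) (0, 0) /\
  is_3cycle f (phi, phi) (theta, 1) (0, theta) /\
  (* each of the three behaviors occurs *)
  (exists p, in_triangle p /\ remains_at f p pstar) /\
  (exists p, in_triangle p /\ reaches_cycle f p (1, 1) (0, 1) (0, 0)) /\
  (exists p, in_triangle p /\
     reaches_cycle f p (phi, phi) (theta, 1) (0, theta)) /\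
  (* there is no other one *)
  (forall p, in_triangle p ->
     remains_at f p pstar \/
     reaches_cycle f p (1, 1) (0, 1) (0, 0) \/
     reaches_cycle f p (phi, phi) (theta, 1) (0, theta)).

Proof.
intros theta phi f pstar.
set (a := v1 / v3); set (b := v2 / v3).
assert (Ea : v1 = a * v3) by (unfold a; field; lra).
assert (Eb : v2 = b * v3) by (unfold b; field; lra).
assert (hb : 1 <= b < a) by nra.
assert (hab : 1 < a * b) by nra.
assert (Etheta : theta = a * (b - 1) / (a * b - 1)).
{ unfold theta; rewrite Ea, Eb; field; nra. }
assert (Ephi : phi = b * (a - 1) / (a * b - 1)).
{ unfold phi; rewrite Ea, Eb; field; nra. }
assert (Epstar : pstar = (a / (a + b + 1), (a + b) / (a + b + 1))).
{ unfold pstar; rewrite Ea, Eb; f_equal; field; nra. }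
clearbody theta phi pstar.
assert (Ef : forall p, in_triangle p -> f p = brigade a b p).
{ intros p hp; now apply reset_brigade. }
assert (reaches : forall p u v w, in_triangle p ->
  reaches_cycle (brigade a b) p u v w -> reaches_cycle f p u v w).
{ intros p u v w hp [k H]; exists k; unfold f.
  now rewrite (proj2 (iter_reset v1 v2 v3 p k hv1 hv2 hv3 hp)). }
assert (dichotomy : forall p, in_triangle p -> p = pstar \/
  reaches_cycle f p (1, 1) (0, 1) (0, 0) \/
  reaches_cycle f p (phi, phi) (theta, 1) (0, theta)).
{ intros p hp; rewrite Epstar, Ephi, Etheta.
  destruct (fixed_or_settles a b p hb hp) as [E|[E|E]];
    [now left|right; left|right; right]; now apply reaches. }
(* The strict bounds [0 < phi] and [theta < 1] keep the cycle points distinct. For [v2 = v3] one has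
   [phi = 1] and [theta = 0], and both cycles coincide. *)
assert (hphi : 0 < phi <= 1).
{ rewrite Ephi; split; [apply Rdiv_lt_0_compat|apply Rle_div_l]; nra. }
assert (htheta : 0 <= theta < 1).
{ rewrite Etheta; split; [apply Rle_mult_inv_pos|apply Rlt_div_l]; nra. }
assert (E1 : a * (1 - phi) = theta) by (rewrite Ephi, Etheta; field; lra).
assert (E2 : b * (1 - theta) = phi) by (rewrite Ephi, Etheta; field; lra).
assert (C1 : is_3cycle f (1, 1) (0, 1) (0, 0)).
{ assert (T : in_triangle (1, 1) /\ in_triangle (0, 1) /\ in_triangle (0, 0))
    by (unfold in_triangle; cbn [fst snd]; lra).
  split; [easy|split; [repeat split; intros K; injection K; lra|]].
  rewrite !Ef, brigade_diagonal, brigade_edge, brigade_wall by (easy || lra).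
  rewrite Rmin_left, Rmin_right by lra; repeat split; f_equal; lra. }
assert (C2 : is_3cycle f (phi, phi) (theta, 1) (0, theta)).
{ assert (T : in_triangle (phi, phi) /\ in_triangle (theta, 1) /\
              in_triangle (0, theta))
    by (unfold in_triangle; cbn [fst snd]; lra).
  split; [easy|split].
  { repeat split; intros K; injection K; intros; lra. }
  rewrite !Ef, brigade_diagonal, brigade_edge, brigade_wall by (easy || lra).
  now rewrite E1, E2, !Rmin_left by lra. }
assert (Tstar : in_triangle pstar).
{ rewrite Epstar; unfold in_triangle; cbn [fst snd]; repeat split.
  - apply Rle_mult_inv_pos; lra.
  - apply Rmult_le_compat_r; [apply Rlt_le, Rinv_0_lt_compat|]; lra.
  - apply Rle_div_l; lra. }
assert (Fstar : f pstar = pstar).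
{ rewrite Ef by easy; rewrite Epstar; unfold brigade; cbn [fst snd].
  replace (a * (1 - (a + b) / (a + b + 1))) with (a / (a + b + 1))
    by (field; lra).
  replace (a / (a + b + 1) + b * (1 - (a + b) / (a + b + 1)))
    with ((a + b) / (a + b + 1)) by (field; lra).
  rewrite Epstar in Tstar; unfold in_triangle in Tstar; cbn [fst snd] in Tstar.
  now rewrite (Rmin_left (_ / _) 1), Rmin_left by lra. }
assert (remains : remains_at f pstar pstar).
{ intros k; induction k as [|k IH]; [easy|]; rewrite Nat.iter_succ; congruence. }
split; [split; [easy|split; [easy|]]|split; [easy|split; [easy|repeat split]]].
(* A fixed point other than [pstar] would have to reach one of the 3-cycles. *)
- intros p hp E; destruct (dichotomy p hp) as [|[K|K]]; [easy| |];
    now apply fixed_not_reaches_cycle in K.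
- now exists pstar.
- exists (1, 1); split; [apply C1|exists 0%nat; now left].
- exists (phi, phi); split; [apply C2|exists 0%nat; now left].
- intros p hp; destruct (dichotomy p hp) as [->|K]; [now left|now right].
Qed.
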